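(* Let $f:\mathbb{R}^d\to\mathbb{R}$ be $(\mu,\tau)$-restricted strongly convex and $(L,\tau)$-restricted smooth on $\mathbb{R}^d$. Let $s\ge s^*>0$ be integers, $\bar L=L+3\tau s$, $\bar\mu=\mu-3\tau s$, $\bar\kappa=\bar L/\bar\mu$, and assume $\bar\mu>0$ and $s\ge(240\bar\kappa)^2s^*$. Let $\widehat f\ge f^*:=\min_{\|\theta\|_0\le s^*}f(\theta)$ and let $\widehat\theta$ be any $s^*$-sparse vector with $f(\widehat\theta)=\widehat f$. Let $\{\theta_t\}$ be the iterates generated by Sparse Polyak IHT (defined in the context) with function $f$, target value $\widehat f$ and sparsity parameter $s$. Then for any iterate $\theta_t$ such that $\|\theta_t-\widehat\theta\|^2\ge\frac{36\|\mathrm{HT}_s(\nabla f(\widehat\theta))\|^2}{\bar\mu^2}$, $$\|\theta_{t+1}-\widehat\theta\|^2\le\Big(1-\frac{1}{80\bar\kappa}\Big)\|\theta_t-\widehat\theta\|^2 .$$ Moreover, if $t_0\ge0$ is the first iteration for which $\|\theta_{t_0}-\widehat\theta\|^2<\frac{36\|\mathrm{HT}_s(\nabla f(\widehat\theta))\|^2}{\bar\mu^2}$, then for all $t\ge t_0$, $$\|\theta_t-\widehat\theta\|^2\le\Big(1+\frac{1}{80\bar\kappa}\Big)\frac{36\|\mathrm{HT}_s(\nabla f(\widehat\theta))\|^2}{\bar\mu^2}.$$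
   Context: $\|\cdot\|$ is the Euclidean norm, $\|\cdot\|_1$ the $\ell_1$-norm, and $\|x\|_0=|\{i:x_i\ne0\}|$; $x$ is $k$-sparse if $\|x\|_0\le k$. The function $f$ is differentiable, $\mu,L>0$, $\tau\ge0$. Restricted strong convexity $(\mu,\tau)$: for all $\theta_1,\theta_2\in\mathbb{R}^d$, $\frac{\mu}{2}\|\theta_1-\theta_2\|^2-\frac{\tau}{2}\|\theta_1-\theta_2\|_1^2\le f(\theta_1)-f(\theta_2)-\langle\nabla f(\theta_2),\theta_1-\theta_2\rangle$. Restricted smoothness $(L,\tau)$: for all $\theta_1,\theta_2\in\mathbb{R}^d$, $f(\theta_1)-f(\theta_2)-\langle\nabla f(\theta_2),\theta_1-\theta_2\rangle\le\frac{L}{2}\|\theta_1-\theta_2\|^2+\frac{\tau}{2}\|\theta_1-\theta_2\|_1^2$. Hard thresholding: $\mathrm{HT}_s(z)=\mathrm{argmin}_{\|\theta\|_0\le s}\|\theta-z\|$, ties broken lexicographically (it keeps the $s$ largest-magnitude entries of $z$ and sets the rest to zero). Sparse Polyak IHT (Algorithm 1 of the paper), with inputs $f$, target value $\widehat f$, sparsity parameter $s$: start from any $\theta_0\in\mathbb{R}^d$ with $\|\theta_0\|_0\le s$; for $t=0,1,2,\dots$ set $$\gamma_t=\frac{\max\{f(\theta_t)-\widehat f,0\}}{5\|\mathrm{HT}_s(\nabla f(\theta_t))\|^2},\qquad \theta_{t+1}=\mathrm{HT}_s(\theta_t-\gamma_t\nabla f(\theta_t)).$$ (If $\nabla f(\theta_t)=0$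 the update gives $\theta_{t+1}=\theta_t$ whatever value is assigned to $\gamma_t$.) *)

(* Defs.v *)
From mathcomp Require Import all_boot all_order all_algebra.
From mathcomp Require Import all_classical all_reals all_analysis.

Set Implicit Arguments.
Unset Strict Implicit.
Unset Printing Implicit Defensive.

Import Order.TTheory GRing.Theory Num.Theory.
Import numFieldNormedType.Exports.

Local Open Scope classical_set_scope.
Local Open Scope ring_scope.

(* Vectors of R^d are row vectors. The norm `|x| that the library puts on
   'rV[R]_d is the sup norm, hence the explicit Euclidean and l1 norms below;
   only the topology (through differentiability and derivatives) is taken from
   the library, and it does not depend on the choice of norm. *)

Definition dotv (R : realType) (d : nat) (x y : 'rV[R]_d) : R :=
  \sum_(i < d) x 0 i * y 0 i.

Definition l2norm (R : realType) (d : nat) (x : 'rV[R]_d) : R :=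
  Num.sqrt (dotv x x).

Definition l1norm (R : realType) (d : nat) (x : 'rV[R]_d) : R :=
  \sum_(i < d) `|x 0 i|.

Definition l0norm (R : realType) (d : nat) (x : 'rV[R]_d) : nat :=
  #|[pred i : 'I_d | x 0 i != 0]|.

Definition sparse (R : realType) (d : nat) (k : nat) (x : 'rV[R]_d) : Prop :=
  (l0norm x <= k)%N.

Definition grad (R : realType) (d : nat) (f : 'rV[R]_d -> R) (x : 'rV[R]_d) :
  'rV[R]_d := \row_(i < d) 'D_(delta_mx 0 i) f x.

Definition restricted_strongly_convex (R : realType) (d : nat) (mu tau : R)
    (f : 'rV[R]_d -> R) : Prop :=
  forall x y : 'rV[R]_d,
    mu / 2 * l2norm (x - y) ^+ 2 - tau / 2 * l1norm (x - y) ^+ 2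
      <= f x - f y - dotv (grad f y) (x - y).

Definition restricted_smooth (R : realType) (d : nat) (L tau : R)
    (f : 'rV[R]_d -> R) : Prop :=
  forall x y : 'rV[R]_d,
    f x - f y - dotv (grad f y) (x - y)
      <= L / 2 * l2norm (x - y) ^+ 2 + tau / 2 * l1norm (x - y) ^+ 2.

Definition is_min (R : realType) (A : set R) (m : R) : Prop :=
  A m /\ lbound A m.

Definition sparse_argmin (R : realType) (d : nat) (s : nat) (z : 'rV[R]_d) :
    set 'rV[R]_d :=
  [set x | sparse s x /\
           forall y, sparse s y -> l2norm (x - z) <= l2norm (y - z)].

(* At the first index where the supports of x and y differ, that index lies in
   the support of x. *)
Definition supp_lex_before (R : realType) (d : nat) (x y : 'rV[R]_d) : Prop :=
  exists i : 'I_d, [/\ x 0 i != 0, y 0 i = 0 &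
    forall j : 'I_d, (j < i)%N -> (x 0 j == 0) = (y 0 j == 0)].

(* The best s-sparse approximation whose support comes first lexicographically,
   i.e. among entries of equal magnitude those of smaller index are kept. The
   default value 0 of xget is never used, see HTP. *)
Definition HT (R : realType) (d : nat) (s : nat) (z : 'rV[R]_d) : 'rV[R]_d :=
  xget 0 [set x | sparse_argmin s z x /\
    forall y, sparse_argmin s z y -> y = x \/ supp_lex_before x y].

(* When grad f x = 0 the denominator vanishes; division by 0 yields 0. *)
Definition polyak_step (R : realType) (d : nat) (f : 'rV[R]_d -> R)
    (fhat : R) (s : nat) (x : 'rV[R]_d) : R :=
  Num.max (f x - fhat) 0 / (5 * l2norm (HT s (grad f x)) ^+ 2).

Definition sparse_polyak_iht (R : realType) (d : nat) (f : 'rV[R]_d -> R)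
    (fhat : R) (s : nat) (theta : nat -> 'rV[R]_d) : Prop :=
  sparse s (theta 0%N) /\
  forall t : nat,
    theta t.+1 =
      HT s (theta t - polyak_step f fhat s (theta t) *: grad f (theta t)).

Section HTP.
Variables (R : realType) (d s : nat) (z : 'rV[R]_d).
Implicit Types (x y : 'rV[R]_d) (S : {set 'I_d}).

Let rst S : 'rV[R]_d := \row_i (if i \in S then z 0 i else 0).
Let supp x : {set 'I_d} := [set i | x 0 i != 0]%SET.

Let dotv_ge0 x : 0 <= dotv x x.
Proof. by apply: sumr_ge0 => i _; rewrite -expr2 sqr_ge0. Qed.

Let l2norm_le x y : (l2norm x <= l2norm y) = (dotv x x <= dotv y y).
Proof. by rewrite /l2norm ler_sqrt ?dotv_ge0. Qed.

Let sparse_rst S : (#|S| <= s)%N -> sparse s (rst S).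
Proof.
apply: leq_trans; apply: subset_leq_card; apply/fintype.subsetP => i.
by rewrite inE mxE; case: ifP => // _; rewrite eqxx.
Qed.

Let card_supp x : sparse s x -> (#|supp x| <= s)%N.
Proof. by rewrite cardsE. Qed.

Let dist_rst x (i : 'I_d) :
  ((rst (supp x) - z) 0 i) ^+ 2 <= ((x - z) 0 i) ^+ 2 ?= iff
  (x 0 i == rst (supp x) 0 i).
Proof.
rewrite !mxE inE; case: eqP => [->|/eqP x0] /=; first by apply/leifP; rewrite eqxx.
apply/leifP; rewrite subrr expr0n /=; case: eqP => [->|/eqP xz].
  by rewrite subrr expr0n.
by rewrite exprn_even_gt0 //= subr_eq0.
Qed.

Let argmin_rst x : sparse_argmin s z x -> x = rst (supp x).
Proof.
move=> [sx minx]; apply/rowP => i; apply/eqP.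
have le : dotv (rst (supp x) - z) (rst (supp x) - z) <= dotv (x - z) (x - z)
    ?= iff [forall i, x 0 i == rst (supp x) 0 i].
  by apply: leif_sum => j _; rewrite -!expr2; exact: dist_rst.
have := minx _ (sparse_rst (card_supp sx)); rewrite l2norm_le => le'.
by have := ge_leif le; rewrite le' => /esym/forallP.
Qed.

Let argmin_nonempty : exists x, sparse_argmin s z x.
Proof.
have P0 : (#|(finset.set0 : {set 'I_d})| <= s)%N by rewrite cards0.
pose F S := dotv (rst S - z) (rst S - z).
case: (@arg_minP _ R _ finset.set0 (fun S => #|S| <= s)%N F P0) => S cS minS.
exists (rst S); split; first exact: sparse_rst.
move=> y sy; rewrite l2norm_le; apply: (le_trans (minS _ (card_supp sy))).
by apply: ler_sum => j _; rewrite -!expr2; apply: dist_rst.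
Qed.

Lemma HTP : sparse_argmin s z (HT s z) /\
  forall y, sparse_argmin s z y -> y = HT s z \/ supp_lex_before (HT s z) y.
Proof.
pose agree k x y := forall j : 'I_d, (j < k)%N -> (x 0 j == 0) = (y 0 j == 0).
have step k : exists2 x, sparse_argmin s z x & forall y, sparse_argmin s z y ->
    agree k x y \/ supp_lex_before x y.
  elim: k => [|k [x mx lx]].
    by have [x mx] := argmin_nonempty; exists x => // y _; left.
  have [kd|dk] := ltnP k d; last first.
    exists x => // y /lx[xy|]; [left|by right] => j _; apply: xy.
    exact: leq_trans (ltn_ord j) dk.
  pose k' := Ordinal kd.
  have agreeS u v : agree k u v -> (u 0 k' == 0) = (v 0 k' == 0) ->
      agree k.+1 u v.
    move=> uv uvk j; rewrite ltnS leq_eqVlt => /orP[/eqP jk|/uv //].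
    by rewrite (_ : j = k') //; exact/val_inj.
  have next w : sparse_argmin s z w -> agree k w x -> w 0 k' != 0 ->
      exists2 x, sparse_argmin s z x & forall y, sparse_argmin s z y ->
        agree k.+1 x y \/ supp_lex_before x y.
    move=> mw wx wk; exists w => // y my; case: (lx y my) => [xy|[i [xi yi xy]]].
      have wy : agree k w y by move=> j jk; rewrite wx ?xy.
      case: (eqVneq (y 0 k') 0) => yk; first by right; exists k'; split.
      by left; apply: agreeS; rewrite // (negbTE wk) (negbTE yk).
    have [ik|ki] := ltnP i k.
      right; exists i; split=> //; first by rewrite wx.
      by move=> j ji; rewrite wx ?xy // (ltn_trans ji).
    case: (eqVneq (y 0 k') 0) => yk.
      right; exists k'; split=> // j jk.
      by rewrite wx // xy // (leq_trans _ ki).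
    left; apply: agreeS; last by rewrite (negbTE wk) (negbTE yk).
    by move=> j jk; rewrite wx // xy // (leq_trans _ ki).
  have [[w [mw wx wk]]|now] := pselect (exists w, [/\ sparse_argmin s z w,
      agree k w x & w 0 k' != 0]); first exact: next wk.
  exists x => // y my; case: (lx y my) => [xy|]; last by right.
  left; apply: agreeS => //; apply/eqP/eqP => [|] _; apply/eqP.
    apply: contrapT => /negP yk; apply: now; exists y; split=> //.
    by move=> j jk; rewrite xy.
  by apply: contrapT => /negP xk; apply: now; exists x.
have [x mx lx] := step d.
rewrite /HT; case: xgetP => [_ -> [//]|/(_ x) []]; split => // y my.
case: (lx y my) => [xy|]; [left|by right].
rewrite (argmin_rst my) (argmin_rst mx); congr rst.
by apply/finset.setP => j; rewrite !inE xy.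
Qed.

End HTP.

(* Main.v *)
Require Import Defs.
From mathcomp Require Import all_boot all_order all_algebra.
From mathcomp Require Import all_classical all_reals all_analysis.
From mathcomp Require Import ring lra zify.

Import Order.TTheory GRing.Theory Num.Theory.
Import numFieldNormedType.Exports.

Local Open Scope classical_set_scope.
Local Open Scope ring_scope.

Set Implicit Arguments.
Unset Strict Implicit.

(** Write xh for the target point, g for the gradient at the current iterate x,
D for |x - xh|^2, gap for f x - f xh, and let m, M, k be the constants mubar,
Lbar and kappabar = M / m. Everything happens on coordinate sets of at most 3s
indices, unions of three supports of size at most s; there
|v|_1^2 <= 3s |v|^2, so that f is m-strongly convex and M-smooth in the usual
sense ([rsc_sparse], [rsm_sparse]), and the energy of a vector is at most three
times that of its hard thresholding ([dotv_restrU3_le]).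

One step of the algorithm is an ordinary gradient step restricted to such a set
U, followed by a hard thresholding. As sstar / s <= e^2 with e = 1 / (240 k),
thresholding to s entries loses almost nothing against an sstar-sparse target:
it is a projection up to a factor 1 + 2e ([HT_quasi_projection]). This replaces
the non-expansiveness of a convex projection.

For the gradient step, strong convexity gives <g, x - xh> >= gap + m D / 2, and
the step length gam satisfies gam^2 |HT g|^2 = gam gap^+ / 5, with gap^+ the
positive part; expanding the square, the second-order term 3/5 gam gap^+ is
absorbed by 2 gam gap, whence a factor 1 - gam m ([polyak_step_progress]). A
factor at most 1 + 2e thus holds for every step, near or far.

Far from xh, gam is at least of order 1/M ([polyak_step_ge]). Indeed D then
dominates the gradient at xh, so strong convexity gives gap >= m D / 5
([gap_lower_bound]); and comparing f at xh with f after a step of length 1/M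
along HT g gives |HT g|^2 <= 2 M (gap + m D / 24) <= 5/2 M gap
([HT_grad_upper_bound]). Hence gam m >= 2 / (25 k) >= 19 e, and the factor
(1 + 2e)(1 - 19e) is below 1 - 3e = 1 - 1 / (80 k).

Once inside the ball, an iterate either is in the ball, and the next one is off
by a factor at most 1 + 2e, or is outside, and the next one is closer: the
bound (1 + 3e) radius2 is preserved. *)

(** * Restriction to a set of coordinates *)

Definition supp (R : realType) (d : nat) (x : 'rV[R]_d) : {set 'I_d} :=
  [set i | x 0 i != 0]%SET.

Definition restr (R : realType) (d : nat) (U : {set 'I_d}) (x : 'rV[R]_d) :
  'rV[R]_d := \row_i (if i \in U then x 0 i else 0).

Lemma notin_supp (R : realType) (d : nat) (U : {set 'I_d}) (x : 'rV[R]_d) i :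
  supp x \subset U -> i \notin U -> x 0 i = 0.
Proof.
by move=> /fintype.subsetP sU; apply: contraNeq => xi; apply: sU; rewrite inE.
Qed.

Lemma sparseE (R : realType) (d k : nat) (x : 'rV[R]_d) :
  sparse k x = (#|supp x| <= k)%N.
Proof. by rewrite /sparse /l0norm /supp cardsE. Qed.

Lemma supp_restr (R : realType) (d : nat) (U : {set 'I_d}) (x : 'rV[R]_d) :
  supp (restr U x) \subset U.
Proof.
by apply/fintype.subsetP => i; rewrite inE mxE; case: ifP => // _; rewrite eqxx.
Qed.

Lemma sparse_restr (R : realType) (d k : nat) (U : {set 'I_d}) (x : 'rV[R]_d) :
  (#|U| <= k)%N -> sparse k (restr U x).
Proof. by rewrite sparseE; apply: leq_trans; apply/subset_leq_card/supp_restr. Qed.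

Lemma suppB_sub (R : realType) (d : nat) (U : {set 'I_d}) (x y : 'rV[R]_d) :
  supp x \subset U -> supp y \subset U -> supp (x - y) \subset U.
Proof.
move=> xU yU; apply/fintype.subsetP => i; rewrite inE; apply: contraNT => iU.
by rewrite !mxE (notin_supp xU iU) (notin_supp yU iU) subrr.
Qed.

Lemma suppZ_sub (R : realType) (d : nat) (U : {set 'I_d}) (a : R) (x : 'rV[R]_d) :
  supp x \subset U -> supp (a *: x) \subset U.
Proof.
move=> xU; apply/fintype.subsetP => i; rewrite inE; apply: contraNT => iU.
by rewrite !mxE (notin_supp xU iU) mulr0.
Qed.

Lemma restr_id (R : realType) (d : nat) (U : {set 'I_d}) (x : 'rV[R]_d) :
  supp x \subset U -> restr U x = x.
Proof.
by move=> xU; apply/rowP => i; rewrite mxE; case: ifPn => // /(notin_supp xU) ->.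
Qed.

Lemma restrB (R : realType) (d : nat) (U : {set 'I_d}) (x y : 'rV[R]_d) :
  restr U (x - y) = restr U x - restr U y.
Proof. by apply/rowP => i; rewrite !mxE; case: ifP => // _; rewrite subr0. Qed.

Lemma restrZ (R : realType) (d : nat) (U : {set 'I_d}) (a : R) (x : 'rV[R]_d) :
  restr U (a *: x) = a *: restr U x.
Proof. by apply/rowP => i; rewrite !mxE; case: ifP => // _; rewrite mulr0. Qed.

(** * The inner product *)

Lemma dotv_ge0 (R : realType) (d : nat) (x : 'rV[R]_d) : 0 <= dotv x x.
Proof. by apply: sumr_ge0 => i _; rewrite -expr2 sqr_ge0. Qed.

Lemma sqr_l2norm (R : realType) (d : nat) (x : 'rV[R]_d) :
  l2norm x ^+ 2 = dotv x x.
Proof. by rewrite sqr_sqrtr ?dotv_ge0. Qed.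

Lemma dotv_subZ (R : realType) (d : nat) (c : R) (x y : 'rV[R]_d) :
  dotv (x - c *: y) (x - c *: y)
    = dotv x x - 2 * c * dotv y x + c ^+ 2 * dotv y y.
Proof.
rewrite /dotv !mulr_sumr -sumrB -big_split /=; apply: eq_bigr => i _.
by rewrite !mxE; ring.
Qed.

Lemma dotvZr (R : realType) (d : nat) (a : R) (x y : 'rV[R]_d) :
  dotv x (a *: y) = a * dotv x y.
Proof. by rewrite /dotv mulr_sumr; apply: eq_bigr => i _; rewrite mxE; ring. Qed.

Lemma dotvC (R : realType) (d : nat) (x y : 'rV[R]_d) : dotv x y = dotv y x.
Proof. by apply: eq_bigr => i _; rewrite mulrC. Qed.

(** Both signs come from the squares |y - x / c|^2 and |y + x / c|^2. This is
the form in which every Cauchy-Schwarz estimate is used, with a weight c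
adapted to the strong convexity constant. *)
Lemma dotv_young (R : realType) (d : nat) (c : R) (x y : 'rV[R]_d) : 0 < c ->
  `|dotv x y| <= dotv x x / (2 * c) + c / 2 * dotv y y.
Proof.
move=> c0; have := dotv_ge0 (y - c^-1 *: x); have := dotv_ge0 (y - (- c^-1) *: x).
rewrite !dotv_subZ => hN hP; have {hN} := mulr_ge0 (ltW c0) hN.
have {hP} := mulr_ge0 (ltW c0) hP.
have -> : c * (dotv y y - 2 * c^-1 * dotv x y + c^-1 ^+ 2 * dotv x x) =
  2 * (dotv x x / (2 * c) + c / 2 * dotv y y - dotv x y) by field; lra.
have -> : c * (dotv y y - 2 * - c^-1 * dotv x y + (- c^-1) ^+ 2 * dotv x x) =
  2 * (dotv x x / (2 * c) + c / 2 * dotv y y + dotv x y) by field; lra.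
move=> h1 h2.
by rewrite ler_norml; apply/andP; split; lra.
Qed.

Lemma dotv_restr (R : realType) (d : nat) (U : {set 'I_d}) (x y : 'rV[R]_d) :
  supp y \subset U -> dotv (restr U x) y = dotv x y.
Proof.
move=> yU; apply: eq_bigr => i _; rewrite mxE; case: ifPn => // iU.
by rewrite (notin_supp yU iU) !mulr0.
Qed.

Lemma dotv_restrE (R : realType) (d : nat) (U : {set 'I_d}) (x : 'rV[R]_d) :
  dotv (restr U x) (restr U x) = \sum_(i in U) x 0 i ^+ 2.
Proof.
rewrite big_mkcond /=; apply: eq_bigr => i _.
by rewrite mxE; case: ifP => _; rewrite ?mulr0 ?expr2.
Qed.

(** Cauchy-Schwarz against the constant family 1: the deviations of a from its
mean have a nonnegative sum of squares. *)
Lemma sqr_sum_le (R : realType) (I : finType) (A : {set I}) (a : I -> R) :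
  (\sum_(i in A) a i) ^+ 2 <= #|A|%:R * \sum_(i in A) a i ^+ 2.
Proof.
have [A0|A0] := posnP #|A|.
  by rewrite (cards0_eq A0) !big_set0 expr0n mulr0.
set q := \sum_(i in A) a i ^+ 2; set b := \sum_(i in A) a i.
have n0 : 0 < #|A|%:R :> R by rewrite ltr0n.
have : 0 <= \sum_(i in A) (#|A|%:R * a i - b) ^+ 2.
  by apply: sumr_ge0 => i _; rewrite sqr_ge0.
have -> : \sum_(i in A) (#|A|%:R * a i - b) ^+ 2
   = #|A|%:R * (#|A|%:R * q - b ^+ 2).
  transitivity (#|A|%:R ^+ 2 * q - 2 * #|A|%:R * b * b + \sum_(i in A) b ^+ 2).
    have -> : 2 * #|A|%:R * b * b = \sum_(i in A) 2 * #|A|%:R * b * a i.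
      by rewrite mulr_sumr.
    by rewrite mulr_sumr -sumrB -big_split; apply: eq_bigr => i _ /=; ring.
  by rewrite sumr_const -mulr_natl; ring.
by rewrite pmulr_rge0 // subr_ge0.
Qed.

Lemma sqr_l1norm_le (R : realType) (d : nat) (U : {set 'I_d}) (x : 'rV[R]_d) :
  supp x \subset U -> l1norm x ^+ 2 <= #|U|%:R * dotv x x.
Proof.
move=> xU; have := sqr_sum_le U (fun i => `|x 0 i|).
under [X in _ * X]eq_bigr do rewrite real_normK ?num_real//.
rewrite -dotv_restrE (restr_id xU); congr (_ ^+ 2 <= _).
rewrite big_mkcond; apply: eq_bigr => i _; case: ifPn => // iU.
by rewrite (notin_supp xU iU) normr0.
Qed.

(** * Hard thresholding *)

Lemma dotv_split (R : realType) (d : nat) (U : {set 'I_d}) (x : 'rV[R]_d) :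
  dotv x x = \sum_(i in U) x 0 i ^+ 2 + \sum_(i in ~: U) x 0 i ^+ 2.
Proof.
rewrite [X in X + _]big_mkcond [X in _ + X]big_mkcond -big_split /=.
by apply: eq_bigr => i _; rewrite inE; case: ifP => _; rewrite ?addr0 ?add0r expr2.
Qed.

Lemma dotv_restrB (R : realType) (d : nat) (U : {set 'I_d}) (z : 'rV[R]_d) :
  dotv (restr U z - z) (restr U z - z) = dotv z z - \sum_(i in U) z 0 i ^+ 2.
Proof.
rewrite (dotv_split U z) (dotv_split U (restr U z - z)) [RHS]addrAC subrr.
rewrite [X in X + _]big1 => [|i iU]; last by rewrite !mxE iU subrr expr0n.
rewrite !add0r; apply: eq_bigr => i; rewrite inE => iU.
by rewrite !mxE (negbTE iU) sub0r sqrrN.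
Qed.

Lemma HT_best (R : realType) (d s : nat) (z y : 'rV[R]_d) : sparse s y ->
  dotv (HT s z - z) (HT s z - z) <= dotv (y - z) (y - z).
Proof.
have [[_ best] _] := HTP s z.
by move=> /best; rewrite ler_sqrt ?dotv_ge0.
Qed.

Lemma card_supp_HT (R : realType) (d s : nat) (z : 'rV[R]_d) :
  (#|supp (HT s z)| <= s)%N.
Proof. by have [[+ _] _] := HTP s z; rewrite sparseE. Qed.

(** Replacing the entries of HT s z by those of z on the same support keeps the
vector sparse and removes all the error there, so optimality forces equality.
After this lemma hard thresholding is only a choice of coordinates. *)
Lemma HT_restr (R : realType) (d s : nat) (z : 'rV[R]_d) :
  HT s z = restr (supp (HT s z)) z.
Proof.
set H := HT s z; set S := supp H.
have := HT_best z (sparse_restr z (card_supp_HT s z)); rewrite -/H -/S.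
have E i : i \in ~: S -> (H - z) 0 i ^+ 2 = (restr S z - z) 0 i ^+ 2.
  by rewrite inE => iS; rewrite !mxE (negbTE iS) (notin_supp (subxx S) iS).
rewrite !(dotv_split S) (eq_bigr _ E) lerD2r [leRHS]big1 => [h|i iS]; last first.
  by rewrite !mxE iS subrr expr0n.
apply/rowP => i; rewrite mxE; case: ifPn => [iS|]; last exact: notin_supp.
have h0 j : j \in S -> 0 <= (H - z) 0 j ^+ 2 by rewrite sqr_ge0.
have /psumr_eq0P : \sum_(j in S) (H - z) 0 j ^+ 2 = 0.
  by apply/le_anti; rewrite h sumr_ge0.
by move/(_ h0 i iS)/eqP; rewrite sqrf_eq0 !mxE subr_eq0 => /eqP.
Qed.

Lemma dotv_HT (R : realType) (d s : nat) (z : 'rV[R]_d) :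
  dotv (HT s z) (HT s z) = \sum_(i in supp (HT s z)) z 0 i ^+ 2.
Proof. by rewrite -dotv_restrE -HT_restr. Qed.

(** The squared error of a restriction of z is the energy it leaves out, so the
best restriction captures the most energy. *)
Lemma sum_le_HT (R : realType) (d s : nat) (T : {set 'I_d}) (z : 'rV[R]_d) :
  (#|T| <= s)%N ->
  \sum_(i in T) z 0 i ^+ 2 <= \sum_(i in supp (HT s z)) z 0 i ^+ 2.
Proof.
move=> cT; have := HT_best z (sparse_restr z cT).
by rewrite [in X in X -> _]HT_restr !dotv_restrB lerD2l lerN2.
Qed.

Lemma sumU_le (R : realType) (I : finType) (A B : {set I}) (F : I -> R) :
  (forall i, 0 <= F i) ->
  \sum_(i in A :|: B) F i <= \sum_(i in A) F i + \sum_(i in B) F i.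
Proof.
move=> F0; rewrite big_mkcond [X in X + _]big_mkcond [X in _ + X]big_mkcond.
rewrite -big_split /=; apply: ler_sum => i _; rewrite inE; have := F0 i.
by case: (i \in A); case: (i \in B) => /= ?; lra.
Qed.

(** This is how HT s z, a vector with s entries, controls z on all the
coordinates that one step of the algorithm involves. *)
Lemma dotv_restrU3_le (R : realType) (d s : nat) (A B C : {set 'I_d})
    (z : 'rV[R]_d) :
  (#|A| <= s)%N -> (#|B| <= s)%N -> (#|C| <= s)%N ->
  dotv (restr (A :|: B :|: C) z) (restr (A :|: B :|: C) z)
    <= 3 * dotv (HT s z) (HT s z).
Proof.
move=> /sum_le_HT-/(_ R z) hA /sum_le_HT-/(_ R z) hB /sum_le_HT-/(_ R z) hC.
have F0 i : 0 <= z 0 i ^+ 2 by exact: sqr_ge0.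
rewrite dotv_restrE dotv_HT.
by have := sumU_le (A :|: B) C F0; have := sumU_le A B F0; lra.
Qed.

(** Otherwise exchanging i for j in the support would capture more energy. *)
Lemma HT_swap (R : realType) (d s : nat) (z : 'rV[R]_d) i j :
  i \in supp (HT s z) -> j \notin supp (HT s z) -> z 0 j ^+ 2 <= z 0 i ^+ 2.
Proof.
set S := supp _ => iS jS.
have jS' : j \notin S :\ i by rewrite finset.in_setD1 (negbTE jS) andbF.
have cT : (#|j |: S :\ i| <= s)%N.
  rewrite cardsU1 jS' add1n -[_.+1]/(true + _)%N.
  by have := cardsD1 i S; rewrite iS => <-; exact: card_supp_HT.
have := sum_le_HT z cT; rewrite -/S big_setU1 //= [leRHS](big_setD1 i) //=.
by rewrite lerD2r.
Qed.

(** A support that is not full could be enlarged by j. *)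
Lemma HT_slack (R : realType) (d s : nat) (z : 'rV[R]_d) j :
  (#|supp (HT s z)| < s)%N -> j \notin supp (HT s z) -> z 0 j = 0.
Proof.
set S := supp _ => cS jS.
have cT : (#|j |: S| <= s)%N by rewrite cardsU1 jS.
have := sum_le_HT z cT; rewrite -/S big_setU1 //= gerDr => h.
by apply/eqP; rewrite -sqrf_eq0 eq_le h sqr_ge0.
Qed.

(** On average, an entry of T that is missed is no larger than an entry kept
outside T. When the support is full there are s - k entries kept and at most
sstar - k entries missed, with k the size of the overlap, and
(sstar - k) / (s - k) <= sstar / s. *)
Lemma HT_missed_le (R : realType) (d s sstar : nat) (z : 'rV[R]_d)
    (T : {set 'I_d}) :
  (#|T| <= sstar)%N -> (sstar <= s)%N ->
  s%:R * \sum_(j in T :\: supp (HT s z)) z 0 j ^+ 2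
    <= sstar%:R * \sum_(i in supp (HT s z) :\: T) z 0 i ^+ 2.
Proof.
set S := supp _ => cT ss.
set b := \sum_(j in _) _; set c := \sum_(i in _) _.
have b0 : 0 <= b by apply: sumr_ge0 => i _; exact: sqr_ge0.
have c0 : 0 <= c by apply: sumr_ge0 => i _; exact: sqr_ge0.
have [cS|cS] := ltnP #|S| s.
  (* The support is not full: whatever is missed is zero. *)
  rewrite (_ : b = 0) ?mulr0 ?mulr_ge0 //; apply: big1 => j.
  by rewrite finset.in_setD => /andP[jS _]; rewrite (HT_slack cS jS) expr0n.
have {}cS : #|S| = s by apply/eqP; rewrite eqn_leq cS card_supp_HT.
pose k : nat := #|T :&: S|.
(* Sum the exchange inequality over all pairs (kept, missed). *)
have avg : #|S :\: T|%:R * b <= #|T :\: S|%:R * c.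
  have -> : #|S :\: T|%:R * b
      = \sum_(i in S :\: T) \sum_(j in T :\: S) z 0 j ^+ 2.
    by rewrite sumr_const mulr_natl.
  rewrite exchange_big /= mulr_natl -sumr_const; apply: ler_sum => j.
  rewrite finset.in_setD => /andP[jS _]; apply: ler_sum => i.
  by rewrite finset.in_setD => /andP[_ iS]; exact: (HT_swap iS jS).
have kT : (k + #|T :\: S| = #|T|)%N by exact: cardsID.
have kS : (k + #|S :\: T| = s)%N by rewrite -cS /k finset.setIC cardsID.
have bE : #|T :\: S| = 0%N -> b = 0.
  by move=> n0; rewrite /b (cards0_eq n0) big_set0.
move: (#|S :\: T|) (#|T :\: S|) kT kS avg bE => m n kT kS avg bE.
have [m0|m0] := posnP m.
  have n0 : n = 0%N by lia.
  by rewrite bE // mulr0 mulr_ge0.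
rewrite -(ler_pM2l (x := m%:R)) ?ltr0n //.
have le1 : s%:R * (m%:R * b) <= s%:R * (n%:R * c) by rewrite ler_wpM2l.
have le2 : (s * n)%:R * c <= (sstar * m)%:R * c.
  by rewrite ler_wpM2r // ler_nat; nia.
by move: le2; rewrite !natrM; nra.
Qed.

(** Against the restriction of z to U, thresholding changes the error only on
the entries of x that it drops. There |x_j| <= |z_j| + |z_j - x_j|: the second
term is already in the error, and the z_j have, by [HT_missed_le], at most e^2
times the energy of the entries kept outside the support of x, which are part
of the error as well. A weighted square of the sum gives 1 + e + e^2. *)
Lemma HT_quasi_projection (R : realType) (d s sstar : nat) (e : R)
    (U : {set 'I_d}) (z x : 'rV[R]_d) :
  (sstar <= s)%N -> (0 < s)%N -> 0 < e -> sstar%:R <= e ^+ 2 * s%:R ->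
  sparse sstar x -> supp (HT s z) \subset U -> supp x \subset U ->
  dotv (HT s z - x) (HT s z - x)
    <= (1 + 2 * e) * dotv (restr U z - x) (restr U z - x).
Proof.
move=> ss s0; wlog e1 : e / e <= 1 => [hwlog|].
  (* For e > 1, the case e = 1 is stronger; it is available as sstar <= s. *)
  move=> e0 he sx HU xU; have [e1|e1] := leP e 1; first exact: hwlog.
  apply: (le_trans (hwlog 1 _ _ _ _ _ _)) => //.
    by rewrite expr1n mul1r ler_nat.
  by apply: ler_wpM2r; [exact: dotv_ge0|lra].
move=> e0 he; rewrite sparseE => cx HU xU.
have := HT_missed_le z cx ss.
set H := HT s z; set S := supp H; set T := supp x.
set b := \sum_(j in T :\: S) _; set c := \sum_(i in S :\: T) _ => missed.
have c0 : 0 <= c by apply: sumr_ge0 => i _; exact: sqr_ge0.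
have {missed} bc : b <= e ^+ 2 * c.
  rewrite -(ler_pM2l (x := s%:R)) ?ltr0n //; apply: (le_trans missed).
  by rewrite mulrA ler_wpM2r // mulrC.
(* a is the error of z on the support kept, q its error on the entries of x
   that get dropped. *)
pose a := \sum_(i in S) (z - x) 0 i ^+ 2.
pose q := \sum_(i in T :\: S) (z - x) 0 i ^+ 2.
have q0 : 0 <= q by apply: sumr_ge0 => i _; exact: sqr_ge0.
have ca : c <= a.
  rewrite /a (big_setID T) /= ler_wpDl //.
    by apply: sumr_ge0 => i _; exact: sqr_ge0.
  apply: ler_sum => i; rewrite finset.in_setD => /andP[iT _].
  by rewrite !mxE (notin_supp (subxx T) iT) subr0.
have E : a + q <= dotv (restr U z - x) (restr U z - x).
  rewrite (dotv_split S); apply: lerD.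
    rewrite le_eqVlt; apply/orP; left; apply/eqP; apply: eq_bigr => i iS.
    by rewrite !mxE (fintype.subsetP HU).
  rewrite (big_setID T) /= ler_wpDr //.
    by apply: sumr_ge0 => i _; exact: sqr_ge0.
  have -> : ~: S :&: T = T :\: S by rewrite finset.setIC -finset.setDE.
  apply: ler_sum => i; rewrite finset.in_setD => /andP[_ iT].
  by rewrite !mxE (fintype.subsetP xU).
have F : dotv (H - x) (H - x) = a + \sum_(i in T :\: S) x 0 i ^+ 2.
  rewrite (dotv_split S); congr (_ + _).
    by apply: eq_bigr => i iS; rewrite [H]HT_restr !mxE iS.
  rewrite (big_setID T) /= [X in _ + X]big1 => [|i]; last first.
    rewrite finset.in_setD finset.in_setC => /andP[iT iS].
    by rewrite !mxE (notin_supp (subxx S)) ?(notin_supp (subxx T)) ?subrr ?expr0n.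
  rewrite addr0 finset.setIC -finset.setDE; apply: eq_bigr => i.
  rewrite finset.in_setD => /andP[iS _].
  by rewrite !mxE (notin_supp (subxx S)) ?sub0r ?sqrrN.
have xq : \sum_(i in T :\: S) x 0 i ^+ 2 <= (1 + e^-1) * b + (1 + e) * q.
  rewrite !mulr_sumr -big_split; apply: ler_sum => i _ /=; rewrite !mxE.
  rewrite -subr_ge0.
  set zi := z 0 i; set xi := x 0 i.
  have -> : (1 + e^-1) * zi ^+ 2 + (1 + e) * (zi - xi) ^+ 2 - xi ^+ 2
     = e^-1 * ((zi + e * (zi - xi)) ^+ 2) by field; lra.
  by rewrite mulr_ge0 ?sqr_ge0 // invr_ge0 ltW.
have eb : (1 + e^-1) * b <= 2 * e * a.
  apply: (@le_trans _ _ ((1 + e^-1) * (e ^+ 2 * c))).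
    by rewrite ler_wpM2l // addr_ge0 // invr_ge0 ltW.
  have -> : (1 + e^-1) * (e ^+ 2 * c) = (e ^+ 2 + e) * c by field; lra.
  by apply: ler_pM => //; nra.
rewrite F; apply: (@le_trans _ _ ((1 + 2 * e) * (a + q))); last first.
  by apply: ler_wpM2l => //; lra.
nra.
Qed.

(** * Strong convexity and smoothness along few coordinates *)

Lemma card_setU3_le (T : finType) (s : nat) (A B C : {set T}) :
  (#|A| <= s)%N -> (#|B| <= s)%N -> (#|C| <= s)%N ->
  (#|A :|: B :|: C| <= 3 * s)%N.
Proof. by move=> hA hB hC; have := cardsU (A :|: B) C; have := cardsU A B; lia. Qed.

Definition strongly_convex_along (R : realType) (d : nat) (U : {set 'I_d})
    (m : R) (f : 'rV[R]_d -> R) : Prop :=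
  forall x y : 'rV[R]_d, supp (x - y) \subset U ->
    m / 2 * dotv (x - y) (x - y) <= f x - f y - dotv (grad f y) (x - y).

Definition smooth_along (R : realType) (d : nat) (U : {set 'I_d})
    (M : R) (f : 'rV[R]_d -> R) : Prop :=
  forall x y : 'rV[R]_d, supp (x - y) \subset U ->
    f x - f y - dotv (grad f y) (x - y) <= M / 2 * dotv (x - y) (x - y).

Lemma rsc_sparse (R : realType) (d n : nat) (f : 'rV[R]_d -> R) (mu tau : R)
    (U : {set 'I_d}) :
  0 <= tau -> restricted_strongly_convex mu tau f ->
  (#|U| <= n)%N -> strongly_convex_along U (mu - tau * n%:R) f.
Proof.
move=> tau0 rsc cU x y; have := rsc x y => h /sqr_l1norm_le h1; apply: le_trans h.
rewrite sqr_l2norm; have D0 := dotv_ge0 (x - y).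
have : tau * l1norm (x - y) ^+ 2 <= tau * (n%:R * dotv (x - y) (x - y)).
  by rewrite ler_wpM2l // (le_trans h1) // ler_wpM2r // ler_nat.
lra.
Qed.

Lemma rsm_sparse (R : realType) (d n : nat) (f : 'rV[R]_d -> R) (L tau : R)
    (U : {set 'I_d}) :
  0 <= tau -> restricted_smooth L tau f ->
  (#|U| <= n)%N -> smooth_along U (L + tau * n%:R) f.
Proof.
move=> tau0 rsm cU x y; have := rsm x y => h /sqr_l1norm_le h1; apply: (le_trans h).
rewrite sqr_l2norm; have D0 := dotv_ge0 (x - y).
have : tau * l1norm (x - y) ^+ 2 <= tau * (n%:R * dotv (x - y) (x - y)).
  by rewrite ler_wpM2l // (le_trans h1) // ler_wpM2r // ler_nat.
lra.
Qed.

(** * The gap and the gradient *)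

(** Here g is the gradient at the target and v the displacement from it. A small
linear term <g, v> costs only a fraction of the quadratic one: with weight
m / 4, at most (1/6 + 1/8) m |v|^2, which leaves 5/24 >= 1/5 out of 1/2. *)
Lemma gap_lower_bound (R : realType) (d : nat) (m : R) (U : {set 'I_d})
    (g v : 'rV[R]_d) (gap : R) :
  0 < m -> supp v \subset U ->
  m / 2 * dotv v v <= gap - dotv g v ->
  12 * dotv (restr U g) (restr U g) <= m ^+ 2 * dotv v v ->
  m / 5 * dotv v v <= gap.
Proof.
move=> m0 vU hc hg; have m4 : 0 < m / 4 by lra.
have := dotv_young (restr U g) v m4; rewrite (dotv_restr _ vU) ler_norml.
move=> /andP[h _]; have D0 := dotv_ge0 v.
have : dotv (restr U g) (restr U g) / (2 * (m / 4)) <= m * dotv v v / 6.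
  by rewrite ler_pdivrMr; nra.
nra.
Qed.

Lemma dotv_HTr (R : realType) (d s : nat) (z : 'rV[R]_d) :
  dotv z (HT s z) = dotv (HT s z) (HT s z).
Proof. by rewrite -(dotv_restr z (subxx (supp (HT s z)))) -HT_restr. Qed.

(** The step of length 1 / M along HT s g decreases f by at least
|HT s g|^2 / (2 M), as <g, HT s g> = |HT s g|^2. Since xh need not minimise f,
the resulting value may lie below f xh; but strong convexity at xh limits how
far below, by the energy of the gradient at xh divided by 2 m. *)
Lemma HT_grad_upper_bound (R : realType) (d s : nat) (f : 'rV[R]_d -> R) (m M : R)
    (U : {set 'I_d}) (x xh : 'rV[R]_d) :
  0 < m -> 0 < M ->
  strongly_convex_along U m f -> smooth_along U M f ->
  supp x \subset U -> supp xh \subset U -> supp (HT s (grad f x)) \subset U ->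
  dotv (HT s (grad f x)) (HT s (grad f x))
    <= 2 * M * (f x - f xh
         + dotv (restr U (grad f xh)) (restr U (grad f xh)) / (2 * m)).
Proof.
move=> m0 M0 conv smooth xU xhU HU.
set H := HT s (grad f x); pose y := x - M^-1 *: H.
have yx : y - x = (- M^-1) *: H by rewrite /y addrC addKr scaleNr.
have yU : supp y \subset U by apply: suppB_sub => //; exact: suppZ_sub.
have := smooth y x (suppB_sub yU xU).
rewrite yx dotvZr -/H dotv_HTr -/H.
have -> : dotv (- M^-1 *: H) (- M^-1 *: H) = M^-1 ^+ 2 * dotv H H.
  by rewrite dotvZr dotvC dotvZr; ring.
have vU := suppB_sub yU xhU.
have := conv y xh vU; have := dotv_young (restr U (grad f xh)) (y - xh) m0.
rewrite (dotv_restr _ vU) ler_norml => /andP[hy _] hc hs.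
have {hs} : f y - f x <= - (dotv H H / (2 * M)).
  have -> : - (dotv H H / (2 * M))
    = - M^-1 * dotv H H + M / 2 * (M^-1 ^+ 2 * dotv H H) by field; lra.
  by move: hs; rewrite -/H; lra.
move=> hs.
rewrite mulrC -ler_pdivrMr; [lra|lra].
Qed.

(** * The Polyak step *)

Lemma polyak_step_ge0 (R : realType) (d : nat) (f : 'rV[R]_d -> R) (fhat : R)
    (s : nat) (x : 'rV[R]_d) : 0 <= polyak_step f fhat s x.
Proof.
by rewrite divr_ge0 // ?le_max ?lexx ?orbT // mulr_ge0 // sqr_ge0.
Qed.

(** The choice of the step length: the second-order term of the expansion of the
distance becomes a multiple of the first-order one. When the denominator
vanishes the step is 0 and the identity still holds. *)
Lemma polyak_step_sqrM (R : realType) (d : nat) (f : 'rV[R]_d -> R) (fhat : R)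
    (s : nat) (x : 'rV[R]_d) (gam := polyak_step f fhat s x) :
  gam ^+ 2 * dotv (HT s (grad f x)) (HT s (grad f x))
    = gam * (Num.max (f x - fhat) 0 / 5).
Proof.
rewrite /gam /polyak_step sqr_l2norm; set G := dotv _ _.
have [->|G0] := eqVneq G 0; first by rewrite !(mulr0, invr0, mul0r).
by field.
Qed.

(** Strong convexity bounds the first-order term -2 gam <g, x - xh> by
-2 gam gap - gam m |x - xh|^2, and [polyak_step_sqrM] bounds the second-order
one by 3/5 gam gap^+; this is harmless since gam = 0 when gap <= 0. *)
Lemma polyak_step_progress (R : realType) (d s : nat) (f : 'rV[R]_d -> R)
    (m : R) (U : {set 'I_d}) (x xh : 'rV[R]_d)
    (gam := polyak_step f (f xh) s x) :
  0 < m ->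
  supp x \subset U -> supp xh \subset U ->
  m / 2 * dotv (xh - x) (xh - x) <= f xh - f x - dotv (grad f x) (xh - x) ->
  dotv (restr U (grad f x)) (restr U (grad f x))
    <= 3 * dotv (HT s (grad f x)) (HT s (grad f x)) ->
  dotv (restr U (x - gam *: grad f x) - xh) (restr U (x - gam *: grad f x) - xh)
    <= (1 - gam * m) * dotv (x - xh) (x - xh).
Proof.
move=> m0 xU xhU; set g := grad f x => hc hg.
have D E : dotv E (xh - x) = - dotv E (x - xh).
  by rewrite -[xh - x]opprB -scaleN1r dotvZr mulN1r.
have {hc} hc : f x - f xh + m / 2 * dotv (x - xh) (x - xh) <= dotv g (x - xh).
  move: hc; rewrite !D; rewrite [dotv (xh - x) _]dotvC D.
  lra.
have vU := suppB_sub xU xhU.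
rewrite restrB restrZ (restr_id xU) addrAC dotv_subZ (dotv_restr _ vU).
have gam0 : 0 <= gam := polyak_step_ge0 f (f xh) s x.
have hgam : gam ^+ 2 * dotv (HT s g) (HT s g)
    = gam * (Num.max (f x - f xh) 0 / 5) := polyak_step_sqrM f (f xh) s x.
have h1 : gam ^+ 2 * dotv (restr U g) (restr U g)
    <= 3 / 5 * (gam * Num.max (f x - f xh) 0).
  have := ler_wpM2l (sqr_ge0 gam) hg; move: hgam; lra.
have h2 : gam * Num.max (f x - f xh) 0 = gam * (f x - f xh).
  rewrite /gam /polyak_step; case: leP => // _.
  by rewrite !mul0r.
have h3 := ler_wpM2l gam0 hc.
have h4 : 0 <= gam * Num.max (f x - f xh) 0.
  by rewrite mulr_ge0 // le_max lexx orbT.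
move: h1 h4; rewrite h2; nra.
Qed.

(** The two bounds combine to |HT s g|^2 <= 2 M (1 + 5/24) gap <= 5/2 M gap, and
the step is gap / (5 |HT s g|^2). *)
Lemma polyak_step_ge_of_bounds (R : realType) (d s : nat) (f : 'rV[R]_d -> R)
    (m M D : R) (x xh : 'rV[R]_d) :
  0 < m -> 0 < M -> 0 < D ->
  m / 5 * D <= f x - f xh ->
  0 < dotv (HT s (grad f x)) (HT s (grad f x)) ->
  dotv (HT s (grad f x)) (HT s (grad f x))
    <= 2 * M * (f x - f xh + m * D / 24) ->
  1 <= 25 / 2 * M * polyak_step f (f xh) s x.
Proof.
move=> m0 M0 D0 hgap G0 hG; rewrite /polyak_step sqr_l2norm.
set G := dotv _ _ in G0 hG *; have mD : 0 < m * D by exact: mulr_gt0.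
rewrite max_l; last lra.
rewrite mulrA ler_pdivlMr; last lra.
have : M * (m * D) <= M * (5 * (f x - f xh)) by rewrite ler_wpM2l; lra.
nra.
Qed.

(** Being far from xh means that the gradient at xh is small compared with
m |x - xh|. The conclusion says that the step is at least 2 / (25 M), as for a
fixed step length tuned to the smoothness constant. *)
Lemma polyak_step_ge (R : realType) (d s : nat) (f : 'rV[R]_d -> R) (m M : R)
    (x xh : 'rV[R]_d) (D := dotv (x - xh) (x - xh)) :
  0 < m -> 0 < M ->
  (forall U : {set 'I_d}, (#|U| <= 3 * s)%N -> strongly_convex_along U m f) ->
  (forall U : {set 'I_d}, (#|U| <= 3 * s)%N -> smooth_along U M f) ->
  sparse s x -> sparse s xh ->
  36 * dotv (HT s (grad f xh)) (HT s (grad f xh)) <= m ^+ 2 * D ->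
  0 < D ->
  1 <= 25 / 2 * M * polyak_step f (f xh) s x.
Proof.
move=> m0 M0 conv smooth; rewrite !sparseE => sx sxh far D0.
set H := HT s (grad f x); pose U := supp x :|: supp H :|: supp xh.
have cU : (#|U| <= 3 * s)%N by apply: card_setU3_le => //; exact: card_supp_HT.
have xU : supp x \subset U by rewrite /U -finset.setUA finset.subsetUl.
have xhU : supp xh \subset U by rewrite /U finset.subsetUr.
have HU : supp H \subset U.
  by rewrite /U finset.setUAC finset.subsetUr.
have vU := suppB_sub xU xhU; have wU := suppB_sub xhU xU.
have hU (z : 'rV[R]_d) : dotv (restr U z) (restr U z) <= 3 * dotv (HT s z) (HT s z).
  by apply: dotv_restrU3_le => //; exact: card_supp_HT.
have hgap : m / 5 * D <= f x - f xh.
  apply: (gap_lower_bound m0 vU (conv _ cU _ _ vU)).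
  by have := hU (grad f xh); move: far; rewrite -/D; lra.
have mD : 0 < m * D by exact: mulr_gt0.
apply: (polyak_step_ge_of_bounds m0 M0 D0 hgap); rewrite -/H.
  (* If HT s g = 0, then g vanishes on U, and strong convexity at x would give
     gap <= 0. *)
  rewrite lt_neqAle dotv_ge0 andbT; apply/eqP => H0.
  have := conv _ cU _ _ wU; have := dotv_young (restr U (grad f x)) (xh - x) m0.
  rewrite (dotv_restr _ wU) ler_norml => /andP[hy _] hc.
  have := hU (grad f x); rewrite -/H -H0 mulr0 => h0.
  have : dotv (restr U (grad f x)) (restr U (grad f x)) / (2 * m) <= 0.
    by rewrite pmulr_lle0 // invr_gt0 mulr_gt0.
  move: hc hy hgap mD.
  move: (dotv (grad f x) _) (dotv (xh - x) _) (_ / (2 * m)) (f x) (f xh).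
  by move: D {far D0} => D *; lra.
apply: le_trans.
  exact: HT_grad_upper_bound m0 M0 (conv _ cU) (smooth _ cU) xU xhU HU.
rewrite ler_wpM2l; [by []|lra|].
rewrite lerD2l ler_pdivrMr; last lra.
have := hU (grad f xh); move: far; rewrite -/D; nra.
Qed.

(** * One iteration, and convergence *)

Lemma iht_step_le (R : realType) (d s sstar : nat) (f : 'rV[R]_d -> R)
    (m e : R) (x xh : 'rV[R]_d) (gam := polyak_step f (f xh) s x)
    (x' := HT s (x - gam *: grad f x)) :
  0 < m -> 0 < e -> (0 < s)%N -> (sstar <= s)%N ->
  sstar%:R <= e ^+ 2 * s%:R ->
  (forall U : {set 'I_d}, (#|U| <= 3 * s)%N -> strongly_convex_along U m f) ->
  sparse s x -> sparse sstar xh ->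
  dotv (x' - xh) (x' - xh)
    <= (1 + 2 * e) * ((1 - gam * m) * dotv (x - xh) (x - xh)).
Proof.
move=> m0 e0 s0 ss he conv sx sxh.
have sxh' : (#|supp xh| <= s)%N by move: sxh; rewrite sparseE => /leq_trans; exact.
move: sx; rewrite sparseE => sx.
pose U := supp x :|: supp x' :|: supp xh.
have cU : (#|U| <= 3 * s)%N by apply: card_setU3_le => //; exact: card_supp_HT.
have xU : supp x \subset U by rewrite /U -finset.setUA finset.subsetUl.
have xhU : supp xh \subset U by rewrite /U finset.subsetUr.
have x'U : supp x' \subset U.
  by rewrite /U finset.setUAC finset.subsetUr.
apply: (le_trans (HT_quasi_projection ss s0 e0 he sxh x'U xhU)).
apply: ler_wpM2l; first lra.
apply: polyak_step_progress => //; first exact: conv cU _ _ (suppB_sub xhU xU).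
by apply: dotv_restrU3_le => //; exact: card_supp_HT.
Qed.

Theorem theorem1 (R : realType) (d : nat) (f : 'rV[R]_d -> R)
    (mu L tau : R) (s sstar : nat)
    (fstar fhat : R) (thetahat : 'rV[R]_d) (theta : nat -> 'rV[R]_d)
    (mu_gt0 : 0 < mu) (L_gt0 : 0 < L) (tau_ge0 : 0 <= tau)
    (f_diff : forall x : 'rV[R]_d, differentiable f x)
    (f_rsc : restricted_strongly_convex mu tau f)
    (f_rsm : restricted_smooth L tau f)
    (sstar_gt0 : (0 < sstar)%N) (sstar_le_s : (sstar <= s)%N) :
  let Lbar := L + 3 * tau * s%:R in
  let mubar := mu - 3 * tau * s%:R in
  let kappabar := Lbar / mubar in
  let radius2 := 36 * l2norm (HT s (grad f thetahat)) ^+ 2 / mubar ^+ 2 in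
  0 < mubar ->
  (240 * kappabar) ^+ 2 * sstar%:R <= s%:R ->
  is_min (f @` [set x : 'rV[R]_d | sparse sstar x]) fstar ->
  fstar <= fhat ->
  sparse sstar thetahat ->
  f thetahat = fhat ->
  sparse_polyak_iht f fhat s theta ->
  (forall t : nat,
     radius2 <= l2norm (theta t - thetahat) ^+ 2 ->
     l2norm (theta t.+1 - thetahat) ^+ 2
       <= (1 - 1 / (80 * kappabar)) * l2norm (theta t - thetahat) ^+ 2) /\
  (forall t0 : nat,
     l2norm (theta t0 - thetahat) ^+ 2 < radius2 ->
     (forall u : nat, (u < t0)%N ->
        radius2 <= l2norm (theta u - thetahat) ^+ 2) ->
     forall t : nat, (t0 <= t)%N ->
       l2norm (theta t - thetahat) ^+ 2
         <= (1 + 1 / (80 * kappabar)) * radius2).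
Proof.
move=> M m k r2 m0 hs _ _ sxh <- [s0 iht].
rewrite {}/r2 sqr_l2norm; set r2 := _ / m ^+ 2.
have spos : (0 < s)%N by exact: leq_trans sstar_le_s.
have M0 : 0 < M by rewrite /M ltr_wpDr // !mulr_ge0.
have k0 : 0 < k by exact: divr_gt0.
(* e is the largest square root of sstar / s that the hypothesis allows. *)
pose e := (240 * k)^-1.
have k240 : 0 < 240 * k by lra.
have e0 : 0 < e by rewrite invr_gt0.
have ek : 1 / (80 * k) = 3 * e by rewrite /e; field; lra.
have he : sstar%:R <= e ^+ 2 * s%:R.
  by rewrite /e exprVn ler_pdivlMl; [exact: hs|exact: exprn_gt0].
have conv (U : {set 'I_d}) : (#|U| <= 3 * s)%N -> strongly_convex_along U m f.
  have -> : m = mu - tau * (3 * s)%:R by rewrite /m natrM; ring.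
  exact: rsc_sparse.
have smooth (U : {set 'I_d}) : (#|U| <= 3 * s)%N -> smooth_along U M f.
  have -> : M = L + tau * (3 * s)%:R by rewrite /M natrM; ring.
  exact: rsm_sparse.
have sth t : sparse s (theta t).
  by case: t => // t; rewrite iht sparseE card_supp_HT.
have sxh' : sparse s thetahat by exact: leq_trans sstar_le_s.
pose D t := dotv (theta t - thetahat) (theta t - thetahat).
pose gam t := polyak_step f (f thetahat) s (theta t).
have D0 t : 0 <= D t by exact: dotv_ge0.
have gam0 t : 0 <= gam t by exact: polyak_step_ge0.
have step t : D t.+1 <= (1 + 2 * e) * ((1 - gam t * m) * D t).
  by rewrite /D iht; apply: (iht_step_le (sstar := sstar)).
have far t : r2 <= D t -> D t.+1 <= (1 - 3 * e) * D t.
  move=> rD; have [D00|Dpos] := eqVneq (D t) 0.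
    by have := step t; rewrite D00 !mulr0.
  have {}Dpos : 0 < D t by rewrite lt_neqAle eq_sym Dpos D0.
  have hgam : 1 <= 25 / 2 * M * gam t.
    apply: (polyak_step_ge m0 M0 conv smooth (sth t) sxh' _ Dpos).
    by move: rD; rewrite /r2 ler_pdivrMr ?exprn_gt0 // [D t * _]mulrC.
  have gm : 19 * e <= gam t * m.
    have -> : 19 * e = 19 / 240 * (m / M).
      by rewrite /e /k; field; rewrite !gt_eqF.
    have mM0 : 0 < m / M by exact: divr_gt0.
    have := ler_wpM2l (ltW mM0) hgam; rewrite mulr1.
    have -> : m / M * (25 / 2 * M * gam t) = 25 / 2 * (gam t * m).
      by field; rewrite gt_eqF.
    lra.
  apply: (le_trans (step t)); rewrite mulrA ler_wpM2r //.
  apply: (@le_trans _ _ ((1 + 2 * e) * (1 - 19 * e))).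
    by apply: ler_wpM2l; lra.
  nra.
have near t : D t.+1 <= (1 + 2 * e) * D t.
  apply: (le_trans (step t)); rewrite ler_wpM2l ?ler_piMl //; first lra.
  by rewrite gerBl mulr_ge0 // ltW.
split=> [t|t0 + _ t]; rewrite ek !sqr_l2norm -/(D t.+1) -/(D t); first exact: far.
rewrite -/(D t0) => Dt0; have r0 : 0 <= r2 by exact: le_trans (ltW Dt0).
elim: t => [|t IH].
  rewrite leqn0 => /eqP t00; rewrite t00 in Dt0; nra.
rewrite leq_eqVlt => /orP[/eqP t0t|]; first by rewrite -t0t; nra.
rewrite ltnS => /IH {}IH.
have [Dt|Dt] := leP r2 (D t).
  by apply: le_trans IH; apply: (le_trans (far t Dt)); have := D0 t; nra.
by apply: (le_trans (near t)); have := D0 t; nra.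
Qed.
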